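(* For every prime power $q$ and every positive integer $n$, $$\prod_{\substack{p \in \mathcal{I}_q \\ \deg p \le n}} \left(1 - \frac{1}{\|p\|}\right) \le \frac{1}{e^{\gamma} n}.$$
   Context: $\mathcal{I}_q$ is the set of monic irreducible polynomials in $\mathbb{F}_q[x]$, $\|p\| = q^{\deg p}$, and $\gamma$ is the Euler–Mascheroni constant. *)

(* Defs.v *)
From HB Require Import structures.
From mathcomp Require Import all_boot all_order all_algebra.
From mathcomp Require Import lra.
From mathcomp Require Import all_classical all_reals all_analysis.

Set Implicit Arguments.
Unset Strict Implicit.
Unset Printing Implicit Defensive.

Import Order.TTheory GRing.Theory Num.Theory.
Import numFieldNormedType.Exports.

Local Open Scope classical_set_scope.
Local Open Scope ring_scope.

Definition monic_irreducible (F : finFieldType) : set {poly F} :=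
  [set p | p \is monic /\ irreducible_poly p].
Arguments monic_irreducible : clear implicits.

(* [size p] is [deg p + 1] for nonzero [p]; only nonzero [p] are used. *)
Definition pdeg (F : finFieldType) (p : {poly F}) : nat := (size p).-1.

(* [F] stands for the field with [q = #|F|] elements: every finite field has
   prime power order, and every prime power occurs. *)
Definition pnorm (R : realType) (F : finFieldType) (p : {poly F}) : R :=
  #|F|%:R ^+ pdeg p.
Arguments pnorm R {F} p.

Definition euler_seq (R : realType) : R ^nat :=
  fun n => \sum_(1 <= k < n.+1) k%:R^-1 - ln n%:R.
Arguments euler_seq : clear implicits.

Definition euler_gamma (R : realType) : R := limn (euler_seq R).
Arguments euler_gamma : clear implicits.

(* [limn] returns a default value on divergent sequences, so the existence of
   the limit has to be checked. *)
Lemma cvg_euler_seq (R : realType) : cvgn (euler_seq R).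
Proof.
suff : cvgn [sequence euler_seq R n.+1]_n.
  move=> /cvg_ex[l hl]; apply/cvg_ex; exists l.
  by rewrite -(cvg_shiftS (euler_seq R)).
have ge0 n : ln n.+1%:R <= \sum_(1 <= k < n.+1) k%:R^-1 :> R.
  elim: n => [|n IH]; first by rewrite ln1 big_geq.
  rewrite big_nat_recr//= -(subrK (ln n.+1%:R) (ln n.+2%:R)) addrC.
  apply: lerD => //; rewrite -ln_div ?posrE ?ltr0n//.
  rewrite -[n.+2]addn1 natrD mulrDl divff ?pnatr_eq0// mul1r.
  by apply: le_ln1Dx; rewrite (lt_trans (ltrN10 _))// invr_gt0 ltr0n.
apply: nonincreasing_is_cvgn.
  apply/nonincreasing_seqP => n; rewrite /= /euler_seq big_nat_recr//= -addrA.
  rewrite lerD2l.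
  suff : ln n.+1%:R - ln n.+2%:R <= - n.+2%:R^-1 :> R.
    by move: (ln _) (ln _) (_^-1) => a b c; lra.
  rewrite -ln_div ?posrE ?ltr0n//.
  have -> : n.+1%:R / n.+2%:R = 1 + - n.+2%:R^-1 :> R.
    by rewrite -[n.+1%:R](addrK 1) natr1 mulrBl mul1r divff// pnatr_eq0.
  by apply: le_ln1Dx; rewrite ltrN2 invf_lt1 ?ltr1n ?ltr0n.
exists 0 => _ [n _ <-]; rewrite /= /euler_seq subr_ge0.
apply: (le_trans (ge0 n)); rewrite [leRHS]big_nat_recr//= lerDl.
by rewrite invr_ge0 ler0n.
Qed.

(* Main.v *)
Require Import Defs.
From mathcomp Require Import all_boot all_order all_algebra all_fingroup.
From mathcomp Require Import all_solvable all_field lra.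
From mathcomp Require Import all_classical all_reals all_analysis.

(** Write [q = #|F|]. Since the field with [q ^ m] elements consists of roots
of irreducible polynomials of degree dividing [m],
[q ^ m <= \sum_(deg p %| m) deg p]. Truncating the series of [- ln (1 - x)] at
[x = q ^- deg p] and grouping the terms [x ^+ j / j] according to the exponent
[m = j * deg p] of [1 / q], one gets
[- \sum_(deg p <= n) ln (1 - q ^- deg p) >=
  \sum_(m <= n) (q ^- m / m) * \sum_(deg p %| m) deg p >= \sum_(m <= n) 1 / m].
The right-hand side is at least [euler_gamma + ln n], because the sequence
defining [euler_gamma] is decreasing. *)

Set Implicit Arguments.
Unset Strict Implicit.
Unset Printing Implicit Defensive.

Import Order.TTheory GRing.Theory Num.Theory.
Import numFieldNormedType.Exports.

Local Open Scope ring_scope.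

(** * Counting the elements of an extension of degree [m] *)

Lemma natr_card_field (F : finFieldType) (L : fieldExtType F) :
  #|F|%:R = 0 :> L.
Proof.
rewrite -(rmorph_nat (in_alg L)) /=.
suff -> : #|F|%:R = 0 :> F by rewrite scale0r.
have /= := @cyclic.expg_cardG F [set: F]%G 1%R (finset.in_setT _).
by rewrite FinRing.zmodXgE cardsT => ->.
Qed.

(** [L] is a splitting field of ['X^N - 'X] with [N = #|F| ^ m]. The derivative of this polynomial
    is [-1], so it has [N] distinct roots; these turn out to be all of [L], and
    [#|L| = #|F| ^ \dim L] then gives the degree. *)
Lemma exists_extension_of_degree (F : finFieldType) (m : nat) :
  (0 < m)%N -> exists L : splittingFieldType F, \dim {:L} = m.
Proof.
move=> m_gt0; set N := (#|F| ^ m)%N.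
have N_gt1 : (1 < N)%N by rewrite /N -(exp1n m) ltn_exp2r// finNzRing_gt1.
pose f (K : fieldType) : {poly K} := 'X^N - 'X.
have szf K : size (f K) = N.+1.
  by rewrite size_polyDl size_polyXn// size_polyN size_polyX ltnS.
have [|L] := @FinSplittingFieldFor F (f F).
  by rewrite -size_poly_eq0 szf.
have -> : map_poly (in_alg L) (f F) = f L.
  by rewrite rmorphB /= map_polyXn map_polyX.
move=> [zs fE defL]; exists L.
have Uzs : uniq zs.
  rewrite -separable_prod_XsubC -(eqp_separable fE).
  rewrite separable_poly.unlock derivB derivXn derivX.
  have -> : 'X^(N.-1) *+ N = 0 :> {poly L}.
    rewrite -mulr_natr -polyC_natr natrX natr_card_field expr0n gtn_eqF//.
    by rewrite mulr0.
  by rewrite sub0r -scaleN1r coprimepZr ?coprimep1// oppr_eq0 oner_eq0.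
have /finField_galois_generator[/= a _ Da] : (1 <= {:L})%VS by apply: sub1v.
rewrite /= dimv1 expn1 in Da.
have zsE z : (z \in zs) = (z ^+ N == z).
  by rewrite -root_prod_XsubC -(eqp_root fE) /root !hornerE subr_eq0.
have aE z : (a ^+ m)%g z = z ^+ N.
  rewrite /N; elim: (m) => [|i IH]; first by rewrite gal_id.
  by rewrite expgSr expnSr exprM -IH galM ?Da ?memvf.
(* The roots of [f L] form the field fixed by the [m]-th power of the Frobenius
   automorphism [a]; as they generate [L], they fill it. *)
have zs_full (z : L) : z \in zs.
  have sub : (<<1 & zs>> <= fixedSpace (a ^+ m)%g)%VS.
    rewrite -[X in (_ <= X)%VS]subfield_closed agenvS// subv_add sub1v.
    apply/span_subvP => x; rewrite zsE => /eqP xN.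
    by apply/fixedSpaceP; rewrite aE.
  have /fixedSpaceP : z \in fixedSpace (a ^+ m)%g.
    by apply: (subvP sub); rewrite defL memvf.
  by rewrite zsE aE => ->.
have card_L : #|finvect_type L| = N.
  have -> : #|finvect_type L| = #|(zs : seq (finvect_type L))|.
    by apply: eq_card => z; exact/esym/zs_full.
  rewrite (card_uniqP _)//; apply: succn_inj.
  by rewrite -(size_prod_XsubC _ id) -(eqp_size fE) szf.
have := card_vspace {:finvect_type L}.
have -> : #|{:finvect_type L}%VS| = N.
  by rewrite -card_L; apply: eq_card => z; rewrite memvf.
by move=> /eqP; rewrite eqn_exp2l ?finNzRing_gt1// => /eqP/esym.
Qed.

(** The witness is the minimal polynomial of [x] over [F]: its degree is that of [F(x)] over [F],
    which divides the degree of [L] by the tower law. *)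
Lemma exists_irreducible_annihilator (F : finFieldType) (L : fieldExtType F)
    (x : L) :
  exists p : {poly F}, [/\ p \is monic, irreducible_poly p,
    ((size p).-1 %| \dim {:L})%N & root (map_poly (in_alg L) p) x].
Proof.
have /polyOver1P[p pE] := minPolyOver 1 x.
have szp : size p = (adjoin_degree 1 x).+1.
  by rewrite -(size_map_poly (in_alg L)) -pE size_minPoly.
exists p; split.
- by rewrite -(map_monic (in_alg L)) -pE monic_minPoly.
- split=> [|q q_neq1 q_dvd]; first by rewrite szp.
  have q_over : map_poly (in_alg L) q \is a polyOver 1%VS.
    by apply/polyOver1P; exists q.
  have := q_dvd; rewrite -(dvdp_map (in_alg L)) -pE => /(minPoly_irr q_over).
  by rewrite pE eqp_map -size_poly_eq1 size_map_poly (negPf q_neq1) orbF.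
- have := dim_Fadjoin 1 x.
  rewrite dimv1 muln1 szp/= => <-; exact/field_dimS/subvf.
- by rewrite -pE root_minPoly.
Qed.

Lemma sum_root_le (F : fieldType) (L : finFieldType) (f : {rmorphism F -> L})
    (p : {poly F}) :
  p != 0 -> (\sum_(x : L) root (map_poly f p) x <= (size p).-1)%N.
Proof.
move=> p_neq0; rewrite -big_mkcond/= sum1_card cardE -ltnS.
rewrite prednK ?size_poly_gt0// -(size_map_poly f).
apply: max_poly_roots; rewrite ?map_poly_eq0 ?enum_uniq//.
by apply/allP => x; rewrite mem_enum.
Qed.

Lemma monic_irreducibleP (F : finFieldType) (p : {poly F}) :
  reflect (p \is monic /\ irreducible_poly p) (p \in monic_irreducible F).
Proof. by apply: (iffP idP) => [/set_mem|?]; last exact/mem_set. Qed.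

(** Double counting of pairs ([p], root of [p]) in the extension of degree [m]: each element is a
    root of at least one [p], and each [p] has at most [pdeg p] roots. As [pdeg p] divides [m <= n],
    the finite type of polynomials of degree at most [n] contains every [p] required. *)
Lemma card_exp_le_sum_pdeg (F : finFieldType) (n m : nat) :
  (0 < m <= n)%N ->
  (#|F| ^ m <= \sum_(p : {poly_n.+1 F} |
      (polyn p \in monic_irreducible F) && (pdeg p %| m)) pdeg p)%N.
Proof.
move=> /andP[m_gt0 mn]; have [L dimL] := exists_extension_of_degree F m_gt0.
pose K := FinFieldExtType L; pose f : {rmorphism F -> K} := in_alg L.
have -> : (#|F| ^ m)%N = #|K|.
  rewrite -dimL -(card_vspace {:finvect_type L}).
  by apply: eq_card => z; rewrite memvf.
apply: (@leq_trans (\sum_(p : {poly_n.+1 F} |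
    (polyn p \in monic_irreducible F) && (pdeg p %| m))
    \sum_(x : K) root (map_poly f p) x)%N); last first.
  apply: leq_sum => p /andP[/monic_irreducibleP[/monic_neq0 p_neq0 _] _].
  exact: sum_root_le.
rewrite exchange_big/= -sum1_card; apply: leq_sum => x _.
have [p [p_monic p_irr p_dvd px]] := exists_irreducible_annihilator (x : L).
rewrite dimL in p_dvd.
have szp : (size p <= n.+1)%N.
  by rewrite (leq_trans (leqSpred _))// ltnS (leq_trans (dvdn_leq m_gt0 p_dvd)).
rewrite (bigD1 (npolyp n.+1 p))/=; last first.
  by rewrite npolypK// p_dvd andbT; apply/monic_irreducibleP.
by rewrite npolypK// px.
Qed.

(** * Harmonic sums and the truncated logarithm *)

(** This is [ln (1 + x) <= x] at [x = - 1 / (n + 1)]. It fails at index 0, where the convention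
    [ln 0 = 0] makes [euler_seq] vanish, while its next value is 1. *)
Lemma euler_seqS (R : realType) (n : nat) : (0 < n)%N ->
  euler_seq R n.+1 <= euler_seq R n.
Proof.
case: n => // n _; rewrite /euler_seq big_nat_recr//= -addrA lerD2l.
have : ln (n.+1%:R / n.+2%:R) <= - n.+2%:R^-1 :> R.
  have -> : n.+1%:R / n.+2%:R = 1 + - n.+2%:R^-1 :> R.
    by rewrite -[n.+1%:R](addrK 1) natr1 mulrBl mul1r divff// pnatr_eq0.
  by apply: le_ln1Dx; rewrite ltrN2 invf_lt1 ?ltr1n ?ltr0n.
rewrite ln_div ?posrE ?ltr0n//.
by move: (ln _) (ln _) (_^-1) => a b c; lra.
Qed.

Lemma euler_gamma_le (R : realType) (n : nat) : (0 < n)%N ->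
  euler_gamma R <= euler_seq R n.
Proof.
case: n => // n _.
have cvgS : ((fun k => euler_seq R k.+1) @ \oo --> euler_gamma R)%classic.
  by rewrite (cvg_shiftS (euler_seq R)); exact: cvg_euler_seq.
rewrite -(cvg_lim _ cvgS)//.
apply: (@nonincreasing_cvgn_ge _ (fun k => euler_seq R k.+1)).
  by apply/nonincreasing_seqP => k; exact: euler_seqS.
by apply/cvg_ex; exists (euler_gamma R).
Qed.

(** Division by [k] is injective on the multiples of [k] and sends those in [1..n] into [1..n]; the
    indices it misses contribute nonnegative terms. *)
Lemma sum_dvdn_le (R : realType) (f : nat -> R) (n k : nat) : (0 < k)%N ->
  (forall j, 0 <= f j) ->
  \sum_(1 <= m < n.+1 | (k %| m)%N) f (m %/ k)%N <= \sum_(1 <= j < n.+1) f j.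
Proof.
move=> k_gt0 f_ge0.
have -> : \sum_(1 <= m < n.+1 | (k %| m)%N) f (m %/ k)%N =
   \sum_(j <- [seq (m %/ k)%N | m <- index_iota 1 n.+1 & (k %| m)%N]) f j.
  by rewrite big_map big_filter.
set s := [seq _ | _ <- _ & _].
have Us : uniq s.
  rewrite map_inj_in_uniq ?filter_uniq ?iota_uniq// => x y.
  rewrite !mem_filter => /andP[kx _] /andP[ky _] e.
  by rewrite -(divnK kx) -(divnK ky) e.
have sE : {subset s <= index_iota 1 n.+1}.
  move=> _ /mapP[m + ->]; rewrite mem_filter !mem_index_iota.
  move=> /andP[km /andP[m1 mn]].
  rewrite divn_gt0// (dvdn_leq m1 km)/= ltnS (leq_trans (leq_div _ _))//.
rewrite [leRHS](bigID [in s])/= -[leLHS]addr0 lerD//; last exact: sumr_ge0.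
rewrite -[leRHS]big_filter.
rewrite (perm_big [seq j <- index_iota 1 n.+1 | j \in s]) ?lexx//.
apply: uniq_perm => //; first by rewrite filter_uniq ?iota_uniq.
by move=> j; rewrite mem_filter; case js: (j \in s) => //=; rewrite sE.
Qed.

(** The difference [g] of the two sides vanishes at 0, and its derivative [- y ^+ n / (1 - y)] is
    nonpositive on [[0, 1)]. *)
Lemma ln1B_le (R : realType) (n : nat) (x : R) : 0 <= x < 1 ->
  ln (1 - x) <= - \sum_(1 <= j < n.+1) x ^+ j / j%:R.
Proof.
move=> /andP[x_ge0 x_lt1].
pose g (y : R) := ln (1 - y) + \sum_(1 <= j < n.+1) y ^+ j / j%:R.
have dln (y : R) : y < 1 ->
    is_derive y 1 (fun z : R => ln (1 - z)) (- (1 - y)^-1).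
  move=> y_lt1.
  have d1 : is_derive y 1 (fun z : R => 1 - z) (- 1 : R).
    by apply: is_derive_eq; rewrite add0r mul1r.
  have := @is_derive1_comp _ (@ln R) (fun z : R => 1 - z) y (1 - y)^-1 (-1).
  rewrite mulrN1 => H; apply: H => //.
  by apply: is_derive1_ln; rewrite subr_gt0.
have dsum (y : R) :
  is_derive y 1 (fun z : R => \sum_(1 <= j < n.+1) z ^+ j / j%:R)
    (\sum_(i < n) y ^+ i).
  elim: n {g} => [|m IH].
    under eq_fun do rewrite big_geq//.
    by rewrite big_ord0; exact: is_derive_cst.
  under eq_fun do rewrite big_nat_recr//=.
  rewrite big_ord_recr/=; apply: is_deriveD.
  have dX : is_derive y 1 (fun z : R => z ^+ m.+1) (m.+1%:R * y ^+ m).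
    have := @is_deriveX _ _ (@id R) m.+1 y 1 1 _.
    by rewrite exprfctE /GRing.scale/= mulr1; apply; exact: is_derive_id.
  apply: is_derive_eq.
  by rewrite !scaler0 add0r /GRing.scale/= mulrA mulVf ?mul1r// pnatr_eq0.
have dg (y : R) : y < 1 -> is_derive y 1 g (- (1 - y)^-1 + \sum_(i < n) y ^+ i).
  by move=> y_lt1; apply: is_deriveD; exact: dln.
suff : g x <= g 0.
  have -> : g 0 = 0.
    rewrite /g subr0 ln1 add0r big_nat big1// => j /andP[j_gt0 _].
    by rewrite expr0n gtn_eqF// mul0r.
  by rewrite /g -lerBrDr sub0r.
apply: (@ler0_derive1_nincr _ g 0 x) => //.
- move=> y; rewrite in_itv/= => /andP[_ yx].
  exact: (@ex_derive _ _ _ _ _ _ _ (dg y (lt_trans yx x_lt1))).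
- move=> y; rewrite in_itv/= => /andP[y_gt0 yx].
  have y_lt1 := lt_trans yx x_lt1.
  rewrite derive1E (@derive_val _ _ _ _ _ _ _ (dg y y_lt1)) addrC subr_le0.
  have y1 : 0 < 1 - y by rewrite subr_gt0.
  (* The geometric sum times [1 - y] telescopes to [1 - y ^+ n]. *)
  rewrite -[leRHS]mul1r ler_pdivlMr// mulrC.
  have := subrX1 y n; rewrite -opprB -[y - 1]opprB mulNr => /oppr_inj <-.
  by rewrite gerBl exprn_ge0// ltW.
- apply: derivable_within_continuous => y; rewrite in_itv/= => /andP[_ yx].
  exact: (@ex_derive _ _ _ _ _ _ _ (dg y (le_lt_trans yx x_lt1))).
Qed.

Theorem proposition3p3 (R : realType) (F : finFieldType) (n : nat) :
  (0 < n)%N ->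
  \prod_(p : {poly_n.+1 F} | polyn p \in monic_irreducible F)
      (1 - 1 / pnorm R p)
    <= 1 / (expR (euler_gamma R) * n%:R).
Proof.
move=> n_gt0.
have -> : 1 / (expR (euler_gamma R) * n%:R) =
    expR (- (euler_gamma R + ln n%:R)).
  by rewrite expRN expRD lnK ?posrE ?ltr0n// div1r.
have q_gt1 : 1 < #|F|%:R :> R by rewrite ltr1n finNzRing_gt1.
have q_gt0 : 0 < #|F|%:R :> R := lt_trans ltr01 q_gt1.
pose S (p : {poly F}) : R := \sum_(1 <= j < n.+1) (pnorm R p)^-1 ^+ j / j%:R.
apply: (@le_trans _ _ (\prod_(p : {poly_n.+1 F} |
    polyn p \in monic_irreducible F)
    expR (- S p))).
  (* Irreducibility forces positive degree, so [(pnorm R p)^-1] lies in [[0, 1)] and [ln1B_le]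
     applies. *)
  apply: ler_prod => p /monic_irreducibleP[_ [p_size _]].
  have x_lt1 : (pnorm R p)^-1 < 1.
    rewrite invf_lt1 ?exprn_gt0// exprn_egt1// -lt0n /pdeg.
    by case: (size p) p_size => [|[]].
  have x_ge0 : 0 <= (pnorm R p)^-1 by rewrite invr_ge0 exprn_ge0// ltW.
  rewrite div1r subr_ge0 ltW//= -[leLHS]lnK ?posrE ?subr_gt0//.
  by rewrite ler_expR ln1B_le// x_ge0.
rewrite -expR_sum ler_expR sumrN lerN2.
have : euler_gamma R + ln n%:R <= \sum_(1 <= m < n.+1) m%:R^-1.
  by rewrite -lerBrDr; exact: euler_gamma_le.
move=> /le_trans; apply.
apply: (@le_trans _ _ (\sum_(1 <= m < n.+1) \sum_(p : {poly_n.+1 F} |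
    (polyn p \in monic_irreducible F) && (pdeg p %| m)%N)
    #|F|%:R ^- m / m%:R * (pdeg p)%:R)).
  (* For fixed [m] the degrees add up to at least [#|F| ^ m], which cancels the factor
     [#|F|%:R ^- m]. *)
  rewrite big_nat [leRHS]big_nat; apply: ler_sum => m /andP[m_gt0 mn].
  rewrite -mulr_sumr -natr_sum mulrAC ler_peMl ?invr_ge0// mulrC.
  rewrite ler_pdivlMr ?exprn_gt0// mul1r -natrX ler_nat.
  by rewrite card_exp_le_sum_pdeg// m_gt0.
rewrite (exchange_big_dep (fun p : {poly_n.+1 F} =>
  polyn p \in monic_irreducible F))/=; last by move=> m p _ /andP[].
apply: ler_sum => p p_irr.
have d_gt0 : (0 < pdeg p)%N.
  move: p_irr => /monic_irreducibleP[_ [+ _]].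
  by rewrite /pdeg; case: size => [|[]].
(* For [m = k * pdeg p], the term [#|F|%:R ^- m / m%:R * (pdeg p)%:R] equals
   [(pnorm R p)^-1 ^+ k / k%:R], a term of [S p]. *)
apply: le_trans (sum_dvdn_le
  (f := fun j => (pnorm R p)^-1 ^+ j / j%:R) n d_gt0 _).
  rewrite big_seq_cond [leRHS]big_seq_cond le_eqVlt; apply/orP; left; apply/eqP.
  apply: eq_big => m; first by rewrite p_irr.
  rewrite mem_index_iota => /andP[/andP[m_gt0 _] /andP[_ /dvdnP[k mE]]].
  have k_gt0 : (0 < k)%N by move: m_gt0; rewrite mE muln_gt0 => /andP[].
  rewrite mE mulnK// /pnorm exprVn -exprM [(pdeg p * k)%N]mulnC.
  by rewrite natrM invfM -!mulrA mulVf ?mulr1// pnatr_eq0 -lt0n.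
by move=> j; rewrite mulr_ge0// ?exprn_ge0// invr_ge0// exprn_ge0// ltW.
Qed.
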